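(* Let $n\ge 0$ and let $a_0,\dots,a_n$, $b_0,\dots,b_n$, $c_1,\dots,c_n$ be nonnegative integers, and set $c_0=1$. Define $A_n,B_n,C_n$ as the entries of the first column of \[ \prod_{k=0}^{n}\begin{pmatrix} a_k & 1 & 0\\ b_k & 0 & 1\\ c_k & 0 & 0\end{pmatrix}=\begin{pmatrix} A_n & * & *\\ B_n & * & *\\ C_n & * & *\end{pmatrix}. \] Then: (1) $A_n$ equals the number of tilings of the board with cells $0,1,\dots,n$; (2) $B_n$ equals the number of tilings of the board with cells $-1,0,1,\dots,n$ whose first piece (the one covering cell $-1$) is a domino or a bar, where no square piece may be placed on cell $-1$; (3) $C_n$ equals the number of tilings of the board with cells $1,\dots,n$ (for $n=0$ this is the empty board, which has exactly one, empty, tiling).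
   Context: A board with cells $m,m+1,\dots,n$ (consecutive integers) is tiled as follows. A tiling is a partition of the set of cells into blocks of consecutive cells of length $1$ (a stack of squares), $2$ (a stack of dominoes) or $3$ (a stack of bars), each block contained in the board, together with a choice of stack height for each block: a length-1 block $\{i\}$ receives a height in $\{1,\dots,a_i\}$ ($a_i$ choices); a length-2 block $\{i-1,i\}$ receives a height in $\{1,\dots,b_i\}$ ($b_i$ choices); a length-3 block $\{i-2,i-1,i\}$ receives a height in $\{1,\dots,c_i\}$ ($c_i$ choices). Thus the number of tilings is the sum, over all partitions into such blocks, of the product of the corresponding numbers $a_i$, $b_i$, $c_i$ (indexed by the last cell of each block). Here the height conditions used are $(a_0,\dots,a_n)$, $(b_0,\dots,b_n)$, $(c_0,\dots,c_n)$ in parts (1) and (2) (in part (2), a domino on cells $\{-1,0\}$ uses $b_0$ and a bar on $\{-1,0,1\}$ uses $c_1$), and $(a_1,\dots,a_n)$, $(b_1,\dots,b_n)$, $(c_1,\dots,c_n)$ in part (3). $(A_n/C_n,B_n/C_n)$ is the $n$-th convergent of the multidimensional continued fraction with partial quotients $(a_i),(b_i),(c_i)$. *)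

(* Defs.v *)
From mathcomp Require Import all_boot all_order all_algebra finmap.
From mathcomp Require Import boolp classical_sets functions cardinality.

Set Implicit Arguments.
Unset Strict Implicit.
Unset Printing Implicit Defensive.

Import GRing.Theory.
Local Open Scope classical_set_scope.
Local Open Scope fset_scope.
Local Open Scope fmap_scope.
Local Open Scope ring_scope.

(* Cells are integers. The sequences of height conditions are indexed by all
   integers; only the values at the last cells of the blocks of a given board
   are ever used. *)

(* [stack a b c B h]: the block B carries a stack of h pieces. The index of the
   height condition is the last cell of the block. *)
Inductive stack (a b c : int -> nat) : {fset int} -> nat -> Prop :=
| Squares (i : int) (h : nat) :
    (1 <= h <= a i)%N -> stack a b c [fset i] h
| Dominoes (i : int) (h : nat) :
    (1 <= h <= b i)%N -> stack a b c [fset i - 1; i] h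
| Bars (i : int) (h : nat) :
    (1 <= h <= c i)%N -> stack a b c [fset i - 2; i - 1; i] h.

Definition board (m n : int) : set int := [set i | m <= i <= n].

(* A tiling is a finite map t: its domain is the set of blocks, and it sends
   each block to the height of the stack placed on it. *)
Definition tiling (a b c : int -> nat) (m n : int)
    (t : {fmap {fset int} -> nat}) : Prop :=
  partition [set` domf t] (fun B : {fset int} => [set` B]) (board m n) /\
  (forall (B : {fset int}) (h : nat), t.[? B] = Some h -> stack a b c B h).

Definition covered_by_domino_or_bar (i : int)
    (t : {fmap {fset int} -> nat}) : Prop :=
  exists2 B : {fset int}, B \in domf t &
    i \in B /\ (#|` B| = 2%N \/ #|` B| = 3%N).

Definition quotient_mx (a b c : int -> nat) (k : int) : 'M[nat]_3 :=
  \matrix_(i < 3, j < 3)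
    (nth [::] [:: [:: a k; 1; 0];
                  [:: b k; 0; 1];
                  [:: c k; 0; 0]] i)`_j.

Definition convergent_mx (a b c : int -> nat) (n : nat) : 'M[nat]_3 :=
  \prod_(k < n.+1) quotient_mx a b c (k : nat)%:Z.

Definition A_ (a b c : int -> nat) (n : nat) : nat :=
  convergent_mx a b c n 0 0.
Definition B_ (a b c : int -> nat) (n : nat) : nat :=
  convergent_mx a b c n 1 0.
Definition C_ (a b c : int -> nat) (n : nat) : nat :=
  convergent_mx a b c n 2 0.

(* Main.v *)
(** Let (A, B, C) be the first column of the product of the last d quotient
    matrices, with indices m, ..., n.  Peeling off the leftmost factor shows, by
    induction on d, that A counts the tilings of m, ..., n, that B counts the
    tilings of m - 1, ..., n beginning with a domino or a bar, and that C counts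
    the tilings of m - 2, ..., n beginning with a bar: in each case the first
    piece either ends at m, with weight a_m, b_m or c_m, or ends further right,
    and is then counted by the next entry of the shorter product.  The theorem is
    the case m = 0, where c_0 = 1 identifies C with the number of tilings of
    1, ..., n. *)

Require Import Defs.
From mathcomp Require Import all_boot all_order all_algebra finmap.
From mathcomp Require Import boolp classical_sets functions cardinality.
From mathcomp Require Import zify.

Set Implicit Arguments.
Unset Strict Implicit.
Unset Printing Implicit Defensive.

Import Order.TTheory GRing.Theory Num.Theory.

Local Open Scope classical_set_scope.
Local Open Scope card_scope.
Local Open Scope ring_scope.

(** * Cardinalities of disjoint unions and products *)

Lemma card_eq_II_fset (T : choiceType) (A : set T) (p : nat) :
  A #= `I_p -> exists2 X : {fset T}, A = [set` X] & #|` X|%fset = p.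
Proof.
move=> Ap; exists (fset_set A); last exact: card_fset_set.
by rewrite fset_setK //; apply/finite_setP; exists p.
Qed.

Lemma card_setU_II (T : choiceType) (A B : set T) (p q : nat) :
  A #= `I_p -> B #= `I_q -> A `&` B = set0 -> A `|` B #= `I_(p + q).
Proof.
move=> /card_eq_II_fset[X -> Xp] /card_eq_II_fset[Y -> Yq].
rewrite -set_fsetI -set_fsetU => XY0; apply/card_eq_fsetP.
suff XY : (X `&` Y)%fset = fset0 by rewrite -Xp -Yq -cardfsUI XY cardfs0 addn0.
by rewrite -[LHS]set_fsetK XY0 fset_set0.
Qed.

Lemma card_setX_II (T U : choiceType) (A : set T) (B : set U) (p q : nat) :
  A #= `I_p -> B #= `I_q -> A `*` B #= `I_(p * q).
Proof.
move=> /card_eq_II_fset[X -> Xp] /card_eq_II_fset[Y -> Yq].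
have -> : [set` X] `*` [set` Y] = [set` (X `*` Y)%fset].
  by apply/seteqP; split=> u /=; rewrite !inE => /andP.
apply/card_eq_fsetP; rewrite -Xp -Yq -(size_allpairs pair).
apply/perm_size/uniq_perm => [||[x y]]; first exact: fset_uniq.
  by apply: allpairs_uniq => [||[x y] [x' y']]; rewrite ?fset_uniq.
rewrite in_fsetM; apply/andP/allpairsP => [[xX yY]|[[x' y'] [? ? [-> ->]]]] //.
by exists (x, y).
Qed.

(* The block of length l whose last cell is i. *)
Definition piece (l : nat) (i : int) : {fset int} :=
  nth fset0 [:: fset0; [fset i]; [fset i - 1; i]; [fset i - 2; i - 1; i]]%fset l.

(** Blocks become integer intervals, so that questions about cells reduce to linear arithmetic. *)
Lemma in_piece (l : nat) (i x : int) :
  (l <= 3)%N -> (x \in piece l i) = (i - l%:Z < x <= i).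
Proof. by case: l => [|[|[|[|]]]] // _; rewrite !inE; lia. Qed.

(** A nonempty interval determines its ends; comparing membership at the first and last cells of
    both blocks suffices. *)
Lemma piece_last (l l' : nat) (i i' : int) : (0 < l <= 3)%N -> (0 < l' <= 3)%N ->
  piece l i = piece l' i' -> (l = l') * (i = i').
Proof.
move=> l3 l'3 /fsetP E.
have {}E x : (i - l%:Z < x <= i) = (i' - l'%:Z < x <= i').
  by rewrite -!in_piece ?E; case/andP: l3; case/andP: l'3.
have := E i; have := E i'; have := E (i - l%:Z + 1); have := E (i' - l'%:Z + 1).
by split; lia.
Qed.

Lemma card_piece (l : nat) (i : int) : (l <= 3)%N -> #|` piece l i|%fset = l.
Proof.
case: l => [|[|[|[|]]]] // _; rewrite /piece /= ?cardfs0 ?cardfs1 //.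
  by rewrite cardfs2; have -> : (i - 1 != i) by lia.
rewrite [X in #|` X|%fset]fsetUC cardfsU1 cardfs2 !inE.
lia.
Qed.


(** * Tilings and removal of their first block *)

Section Tilings.
Variables a b c : int -> nat.
Notation tiling := (tiling a b c).
Notation stack := (stack a b c).

Definition height (l : nat) (i : int) : nat := nth 0%N [:: 0; a i; b i; c i]%N l.

Lemma stackP (B : {fset int}) (h : nat) : stack B h <->
  exists l i, [/\ (0 < l <= 3)%N, B = piece l i & (1 <= h <= height l i)%N].
Proof.
split=> [[] i {}h hi|[[|[|[|[|l]]]]] [i [// _ -> hi]]].
- by exists 1%N, i.
- by exists 2%N, i.
- by exists 3%N, i.
- exact: Squares.
- exact: Dominoes.
- exact: Bars.
Qed.

Lemma stack_piece (l : nat) (i : int) (h : nat) : (0 < l <= 3)%N ->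
  stack (piece l i) h -> (1 <= h <= height l i)%N.
Proof.
by move=> l3 /stackP[l' [i' [l'3 /(piece_last l3 l'3)[<- <-]]]].
Qed.

(** Pointwise form of the partition condition. Nonemptiness of the blocks comes from [stackP], where
    lengths are positive. *)
Lemma tilingP (m n : int) (t : {fmap {fset int} -> nat}) : tiling m n t <->
  [/\ forall x, m <= x <= n <-> exists2 B, B \in domf t & x \in B,
      forall B B' x, B \in domf t -> B' \in domf t -> x \in B -> x \in B' -> B = B'
    & forall B h, t.[? B]%fmap = Some h -> stack B h].
Proof.
split=> [[[cov tri _] st]|[cov tri st]].
  split=> // [x|B B' x Bt B't xB xB'].
    have -> : (m <= x <= n) = board m n x :> Prop by [].
    by rewrite -cov; split=> -[B /= Bt xB]; exists B.
  by apply: tri => //; exists x.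
split=> //; split.
- apply/seteqP; split=> x /=.
    by move=> [B /= Bt xB]; apply/cov; exists B.
  by move=> /cov[B Bt xB]; exists B.
- by move=> B B' Bt B't [x [xB xB']]; apply: (tri _ _ x).
- move=> B /= Bt; have /stackP[l [i [l3 BE _]]] := st _ _ (in_fnd Bt).
  by exists i; rewrite /= BE in_piece; lia.
Qed.

Lemma tiling_piece (m n : int) t B : tiling m n t -> B \in domf t ->
  exists l i, [/\ (0 < l <= 3)%N, B = piece l i, m <= i - l%:Z + 1 & i <= n].
Proof.
move=> /tilingP[cov _ st] Bt; have /stackP[l [i [l3 BE _]]] := st _ _ (in_fnd Bt).
have cB x : x \in B -> m <= x <= n by move=> xB; apply/cov; exists B.
exists l, i; split=> //.
  have := cB (i - l%:Z + 1); rewrite BE in_piece; lia.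
have := cB i; rewrite BE in_piece; lia.
Qed.

(** By disjointness, the other blocks avoid the first one and so cover exactly the cells after
    it. *)
Lemma tiling_rem (m n : int) (l : nat) t : (0 < l <= 3)%N -> tiling m n t ->
  piece l (m + l%:Z - 1) \in domf t ->
  tiling (m + l%:Z) n t.[~ piece l (m + l%:Z - 1)]%fmap.
Proof.
move=> l3; set P := piece _ _ => T Pt; have [cov tri st] := (tilingP _ _ _).1 T.
have PE x : (x \in P) = (m <= x < m + l%:Z) by rewrite /P in_piece; lia.
apply/tilingP; split=> [x|B B' x|B h].
- split.
    move=> xn; have /cov[B Bt xB] : m <= x <= n by lia.
    exists B; rewrite // mem_remf1 Bt andbT; apply: contraTneq xB => ->.
    by rewrite PE; lia.
  move=> [B]; rewrite mem_remf1 => /andP[BP Bt] xB.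
  have : m <= x <= n by apply/cov; exists B.
  suff : x \notin P by rewrite PE; lia.
  by apply: contra_neqN BP => xP; apply: (tri _ _ x).
- by rewrite !mem_remf1 => /andP[_ Bt] /andP[_ B't]; apply: tri.
- by rewrite fnd_rem1; case: ifP => // _ /st.
Qed.

(** The block contains cell [m], which lies to the left of the board. This makes adding the block to
    a tiling injective. *)
Lemma notin_tiling (m n : int) (l : nat) t : (0 < l <= 3)%N ->
  tiling (m + l%:Z) n t -> piece l (m + l%:Z - 1) \notin domf t.
Proof.
move=> l3 /tilingP[cov _ _]; apply/negP => Pt.
have /(_ _)/wrap[] := (cov m).2; last by lia.
by exists (piece l (m + l%:Z - 1)) => //; rewrite in_piece; lia.
Qed.

Lemma tiling_set (m n : int) (l h : nat) t : (0 < l <= 3)%N ->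
  m + l%:Z - 1 <= n -> (1 <= h <= height l (m + l%:Z - 1))%N ->
  tiling (m + l%:Z) n t -> tiling m n t.[piece l (m + l%:Z - 1) <- h]%fmap.
Proof.
move=> l3 mn hh; set P := piece _ _ => /tilingP[cov tri st].
have PE x : (x \in P) = (m <= x < m + l%:Z) by rewrite /P in_piece; lia.
(* The new block meets no old one, since the old ones lie in cells from [m + l] on. *)
have tP x B : B \in domf t -> x \in B -> x \in P -> False.
  move=> Bt xB; rewrite PE; suff : m + l%:Z <= x <= n by lia.
  by apply/cov; exists B.
apply/tilingP; split=> [x|B B' x|B k].
- split.
    move=> xn; case: (boolP (x \in P)) => xP.
      by exists P; rewrite // mem_setf inE eqxx.
    have /cov[B Bt xB] : m + l%:Z <= x <= n by move: xP; rewrite PE; lia.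
    by exists B; rewrite // mem_setf inE Bt orbT.
  move=> [B]; rewrite mem_setf inE => /orP[/eqP->|Bt] xB.
    by move: xB; rewrite PE; lia.
  suff : m + l%:Z <= x <= n by lia.
  by apply/cov; exists B.
- rewrite !mem_setf !inE => /orP[/eqP->|Bt] /orP[/eqP->|B't] // xB xB'.
  + by case: (tP x B').
  + by case: (tP x B).
  + exact: (tri _ _ x).
- rewrite fnd_set; case: eqP => [-> [<-]|_ /st //].
  by apply/stackP; exists l, (m + l%:Z - 1).
Qed.

Definition tilings (m n : int) := [set t | tiling m n t].

(** Pieces are indexed by their last cell, so [m + l - 1] describes the block of length [l] starting
    at [m]. *)
Definition tilings_from (l : nat) (m n : int) :=
  [set t | tiling m n t /\ piece l (m + l%:Z - 1) \in domf t].

Lemma tilings_from_set0 (l : nat) (m n : int) : (0 < l <= 3)%N ->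
  n < m + l%:Z - 1 -> tilings_from l m n = set0.
Proof.
move=> l3 nm; apply/seteqP; split=> // t [/tiling_piece/[apply]].
by move=> [l' [i' [l'3 /(piece_last l3 l'3)[<- <-]]]]; lia.
Qed.

(** Both blocks would cover cell [m], hence coincide, which forces equal lengths. *)
Lemma tilings_from_disj (l l' : nat) (m n : int) :
  (0 < l <= 3)%N -> (0 < l' <= 3)%N -> l <> l' ->
  tilings_from l m n `&` tilings_from l' m n = set0.
Proof.
move=> l3 l'3 ll'; apply/seteqP; split=> // t [[/tilingP[_ tri _] Pt] [_ P't]].
apply: ll'; apply: (piece_last l3 l'3 (tri _ _ m Pt P't _ _)).1.
all: rewrite in_piece; lia.
Qed.

Lemma tilings_split (m n : int) : m <= n ->
  tilings m n =
  tilings_from 1 m n `|` (tilings_from 2 m n `|` tilings_from 3 m n).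
Proof.
move=> mn; apply/seteqP; split=> t; last by move=> [|[]] [].
move=> /= T; have /tilingP[cov _ _] := T.
have /cov[B Bt mB] : m <= m <= n by lia.
have [l [i [l3 BE mi _]]] := tiling_piece T Bt.
(* The block covers [m] and cannot stick out to the left of the board, so it starts at [m]. *)
have {}mi : i = m + l%:Z - 1 by move: mB; rewrite BE in_piece; lia.
suff : tilings_from l m n t by case: l l3 {BE mi} => [|[|[|[|]]]] // _; tauto.
by split=> //; rewrite -mi -BE.
Qed.

(** Such a tiling amounts to a height for the first block together with a tiling of the remaining
    cells. *)
Lemma card_tilings_from (l p : nat) (m n : int) :
  (0 < l <= 3)%N -> m + l%:Z - 1 <= n ->
  tilings (m + l%:Z) n #= `I_p ->
  tilings_from l m n #= `I_(height l (m + l%:Z - 1) * p).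
Proof.
move=> l3 mn Tp; set P := piece l (m + l%:Z - 1).
(* Elements of [I_q] start at 0 and heights at 1, hence the successor. *)
pose f (u : nat * {fmap {fset int} -> nat}) := u.2.[P <- u.1.+1]%fmap.
set q := height _ _.
have -> : tilings_from l m n = f @` (`I_q `*` tilings (m + l%:Z) n).
  apply/seteqP; split=> t.
    move=> [T Pt]; have T' := tiling_rem l3 T Pt.
    have [_ _ /(_ _ _ (in_fnd Pt))/(stack_piece l3) hP] := (tilingP _ _ _).1 T.
    exists ((t.[Pt])%fmap.-1, t.[~ P]%fmap); first by split=> //=; rewrite /q; lia.
    rewrite /f /= setf_rem1 prednK; last by case/andP: hP.
    exact: (setf_get [`Pt]%fset).
  move=> [[h t'] [/= hq T'] <-]; split; first exact: tiling_set.
  by rewrite mem_setf inE eqxx.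
have finj : {in `I_q `*` tilings (m + l%:Z) n &, injective f}.
  move=> [h t] [h' t']; rewrite !inE => -[_ /= T] [_ /= T']; rewrite /f /= => E.
  have : t.[P <- h.+1].[? P]%fmap = t'.[P <- h'.+1].[? P]%fmap by rewrite E.
  rewrite !fnd_set !eqxx => -[hh']; rewrite -hh' in E *.
  suff -> : t = t' by [].
  by apply: setf_inj E; [exact: notin_tiling l3 T|exact: notin_tiling l3 T'].
exact: card_eq_trans (inj_card_eq finj) (card_setX_II (card_eqxx _) Tp).
Qed.

(** * The matrix recurrence and the count *)

Definition convergent_mx_from (m : int) (d : nat) : 'M[nat]_3 :=
  \prod_(k < d) quotient_mx a b c (m + (k : nat)%:Z).
Notation W := convergent_mx_from.

Lemma convergent_mx_fromS (m : int) (d : nat) :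
  [/\ W m d.+1 0 0 = (a m * (W (m + 1) d 0 0)%R + (W (m + 1) d 1 0)%R)%N,
      W m d.+1 1 0 = (b m * (W (m + 1) d 0 0)%R + (W (m + 1) d 2 0)%R)%N
    & W m d.+1 2 0 = (c m * (W (m + 1) d 0 0)%R)%N].
Proof.
have -> : W m d.+1 = quotient_mx a b c m *m W (m + 1)%R d.
  rewrite /W big_ord_recl addr0; congr (_ *m _).
  by apply: eq_bigr => k _; congr quotient_mx; rewrite /= /bump; lia.
have o1 : lift ord0 ord0 = 1 :> 'I_3 by exact: val_inj.
have o2 : lift ord0 (lift ord0 ord0) = 2 :> 'I_3 by exact: val_inj.
by split; rewrite mxE !big_ord_recl big_ord0 !mxE /= ?o1 ?o2 !mul0r ?mul1r;
  rewrite ?add0r ?addr0.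
Qed.

Lemma card_tilings (d : nat) (m n : int) : n = m + d%:Z - 1 ->
  [/\ tilings m n #= `I_((W m d 0 0)%R),
      tilings_from 2 (m - 1) n `|` tilings_from 3 (m - 1) n #= `I_((W m d 1 0)%R)
    & tilings_from 3 (m - 2) n #= `I_((W m d 2 0)%R)].
Proof.
elim: d m => [|d IHd] m nE.
  (* The empty product is the identity, with first column (1, 0, 0). Here [n = m - 1]: the boards
     from [m - 1] and [m - 2] are too short for the required pieces, and only the empty map tiles
     the empty board. *)
  rewrite /W big_ord0 !mxE /= !tilings_from_set0 ?setU0; try lia.

  split; try by rewrite II0 card_eq0.
  suff -> : tilings m n = [set [fmap]%fmap] by exact: card_set1.
  apply/seteqP; split=> t /=.
    move=> T; apply: fmap_nil; apply/eqP; rewrite -[_ == _]negbK.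
    apply/negP => /fset0Pn[B Bt].
    by have [l [i [? _ ? ?]]] := tiling_piece T Bt; lia.
  move=> ->; apply/tilingP; split=> [x|B B' x|B h].
  - by split=> [|[B]]; [lia|rewrite domf0 inE].
  - by rewrite domf0 inE.
  - by rewrite fnd_fmap0.
have [IH0 IH1 IH2] := IHd (m + 1) ltac:(lia).
have [-> -> ->] := convergent_mx_fromS m d.
(* A first block of length [l] ending at [m] leaves the board from [m + 1] to [n]; [l] = 1, 2, 3
   give the leading terms of the three recurrences. *)
have card_from l : (0 < l <= 3)%N ->
    tilings_from l (m - l%:Z + 1) n #= `I_(height l m * (W (m + 1) d 0 0)%R).
  move=> l3; have := @card_tilings_from l ((W (m + 1) d 0 0)%R) (m - l%:Z + 1) n l3.
  have -> : m - l%:Z + 1 + l%:Z = m + 1 by lia.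
  by rewrite addrK; apply=> //; lia.
have := (card_from 1%N isT, card_from 2%N isT, card_from 3%N isT).
rewrite -[m - 1%:Z + 1]/(m - 1 + 1) subrK.
have -> : m - 2%:Z + 1 = m - 1 by lia.
have -> : m - 3%:Z + 1 = m - 2 by lia.
move=> [[c1 c2] c3].
(* The induction hypothesis at [m + 1] counts the tilings whose first piece ends beyond [m], which
   are the remaining terms. *)
rewrite addrK in IH1; have E2 : m + 1 - 2 = m - 1 by lia.
rewrite E2 in IH2; split=> //.
  rewrite tilings_split; last lia.
  by apply: card_setU_II => //; rewrite setIUr !tilings_from_disj ?setU0.
by apply: card_setU_II => //; rewrite tilings_from_disj.
Qed.

(** The block covering the first cell must start there, and its cardinality is its length. *)
Lemma covered_by_domino_or_barE (m n : int) :
  [set t | tiling m n t /\ covered_by_domino_or_bar m t] =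
  tilings_from 2 m n `|` tilings_from 3 m n.
Proof.
apply/seteqP; split=> t.
  move=> [T [B Bt [mB cB]]]; have [l [i [l3 BE mi _]]] := tiling_piece T Bt.
  have {}mi : i = m + l%:Z - 1 by move: mB; rewrite BE in_piece; lia.
  move: cB; rewrite BE card_piece; last by case/andP: l3.
  by move=> [] lE; [left|right]; split=> //; rewrite -lE -mi -BE.
by move=> [] [T Pt]; split=> //; (eexists; first exact: Pt);
  rewrite in_piece // card_piece //; split; [lia|tauto|lia|tauto].
Qed.

End Tilings.

Theorem mainTheorem2 (a b c : int -> nat) (n : nat) (c0 : c 0 = 1%N) :
  [/\ [set t | tiling a b c 0 n%:Z t] #= `I_(A_ a b c n),
      [set t | tiling a b c (-1) n%:Z t /\ covered_by_domino_or_bar (-1) t]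
        #= `I_(B_ a b c n)
    & [set t | tiling a b c 1 n%:Z t] #= `I_(C_ a b c n)].
Proof.
have WE : convergent_mx a b c n = convergent_mx_from a b c 0 n.+1.
  by apply: eq_bigr => k _; rewrite add0r.
have [A B _] := @card_tilings a b c n.+1 0 n ltac:(lia).
(* The third entry is [c 0] times the top entry of the product with indices 1 to [n], so the first
   count is applied with [m = 1] and [n] factors. *)
have [C _ _] := @card_tilings a b c n 1 n ltac:(lia).
rewrite covered_by_domino_or_barE /A_ /B_ /C_ WE; split=> //.
have [_ _ ->] := convergent_mx_fromS a b c 0 n.
by rewrite c0 mul1n.
Qed.
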